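(* Let $\widetilde{s}_n$ be the number of unlabeled split graphs on $n$ vertices and let $\widetilde{u}_n$ be the number of unlabeled unbalanced split graphs on $n$ vertices. Then almost all unlabeled split graphs are balanced: $$\lim_{n\to\infty}\frac{\widetilde{u}_n}{\widetilde{s}_n}=0.$$
   Context: Graphs are finite and simple. A split graph is a graph whose vertices can be partitioned into two (possibly empty) sets $K$ and $S$ such that $K$ is a clique and $S$ is a stable (independent) set; such an ordered partition $(K,S)$ is called a $KS$-partition. A split graph is balanced if it has a unique $KS$-partition, and unbalanced otherwise. Unlabeled graphs on $n$ vertices are isomorphism classes of graphs on $n$ vertices. *)

(* Defs.v *)
From HB Require Import structures.
From mathcomp Require Import all_boot fingroup perm.

Set Implicit Arguments.
Unset Strict Implicit.
Unset Printing Implicit Defensive.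

Definition simple_adj (T : finType) (e : {ffun T * T -> bool}) : bool :=
  [forall x, ~~ e (x, x)] && [forall x, forall y, e (x, y) == e (y, x)].

Record sgraph (T : finType) : predArgType := SGraph {
  sgraph_adj :> {ffun T * T -> bool};
  _ : simple_adj sgraph_adj
}.

HB.instance Definition _ (T : finType) := [isSub for @sgraph_adj T].
HB.instance Definition _ (T : finType) := [Finite of sgraph T by <:].

Definition adj (T : finType) (G : sgraph T) (x y : T) : bool :=
  sgraph_adj G (x, y).

Definition clique (T : finType) (G : sgraph T) (K : {set T}) : bool :=
  [forall x in K, forall y in K, (x != y) ==> adj G x y].

Definition stable (T : finType) (G : sgraph T) (S : {set T}) : bool :=
  [forall x in S, forall y in S, ~~ adj G x y].

(* K and S may be empty, so this does not use finset's [partition], which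
   requires nonempty blocks. *)
Definition KS_partition (T : finType) (G : sgraph T)
    (KS : {set T} * {set T}) : bool :=
  [&& KS.1 :|: KS.2 == [set: T], [disjoint KS.1 & KS.2],
      clique G KS.1 & stable G KS.2].

Definition split_graph (T : finType) (G : sgraph T) : bool :=
  [exists KS, KS_partition G KS].

Definition balanced (T : finType) (G : sgraph T) : bool :=
  #|[set KS | KS_partition G KS]| == 1.

Definition unbalanced_split (T : finType) (G : sgraph T) : bool :=
  split_graph G && ~~ balanced G.

Definition isomorphic (T : finType) (G H : sgraph T) : bool :=
  [exists f : {perm T}, forall x, forall y, adj H (f x) (f y) == adj G x y].

Lemma isomorphic_refl (T : finType) : reflexive (@isomorphic T).
Proof.
by move=> G; apply/existsP; exists 1%g; do 2!apply/forallP=> ?; rewrite !perm1.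
Qed.

Lemma isomorphic_sym (T : finType) : symmetric (@isomorphic T).
Proof.
suff imp (G H : sgraph T) : isomorphic G H -> isomorphic H G.
  by move=> G H; apply/idP/idP; apply: imp.
case/existsP=> f /forallP fGH; apply/existsP; exists (f^-1)%g.
apply/forallP=> x; apply/forallP=> y.
by have /forallP/(_ (f^-1 y)%g)/eqP := fGH (f^-1 x)%g; rewrite !permKV => ->.
Qed.

Lemma isomorphic_trans (T : finType) : transitive (@isomorphic T).
Proof.
move=> H G L /existsP[f /forallP fGH] /existsP[g /forallP gHL].
apply/existsP; exists (f * g)%g; apply/forallP=> x; apply/forallP=> y.
have /forallP/(_ y)/eqP <- := fGH x.
by have /forallP/(_ (f y)) := gHL (f x); rewrite !permM.
Qed.

(* Number of isomorphism classes of graphs on n vertices satisfying P, for an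
   isomorphism-invariant P. *)
Definition num_unlabeled (n : nat) (P : pred (sgraph 'I_n)) : nat :=
  #|equivalence_partition (@isomorphic 'I_n) [set G | P G]|.

Definition num_split (n : nat) : nat := num_unlabeled (@split_graph 'I_n).

Definition num_unbalanced (n : nat) : nat :=
  num_unlabeled (@unbalanced_split 'I_n).

(* Main.v *)
(* An unbalanced split graph on [m + 1] vertices has a vertex [v] lying in some
   KS-partition, adjacent to all of the clique and to none of the stable set;
   removing [v] leaves a [k] by [m - k] biadjacency matrix up to permutations of
   its rows and columns. By Burnside's lemma the number of such matrices, up to
   permutation, is at most [(k+1)(m-k+1) 2^(k(m-k)) / (k! (m-k)!)] unless [k] or
   [m - k] is small, since a permutation moving [a] rows and [b] columns has few
   cycles on the cells. Conversely, a split graph has at most [(n+1)^2]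
   KS-partitions, so there are at least [2^(k s) / (k! s! (n+1)^2)] unlabeled
   split graphs on [n = k + s] vertices. Taking [s = m - k + 1] gains a factor
   [2^k] up to a polynomial, while the terms with [k] or [m - k] less than
   [m / 16] are negligible compared with [2^(n^2/4) / n!]. *)
Require Import Defs.
From HB Require Import structures.
From mathcomp Require Import all_boot all_fingroup zify.

Set Implicit Arguments.
Unset Strict Implicit.
Unset Printing Implicit Defensive.

(** * Counting orbits, invariant sets and permutations with a given number of moved points *)

Lemma leq_card_bigcup (I T : finType) (P : pred I) (F : I -> {set T}) :
  #|\bigcup_(i | P i) F i| <= \sum_(i | P i) #|F i|.
Proof.
elim/big_rec2: _ => [|i m A _ leAm]; first by rewrite cards0.
by apply: leq_trans (leq_card_setU _ _) _; rewrite leq_add2l.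
Qed.

Lemma leq_expn2 (m n e : nat) : m <= n -> m ^ e <= n ^ e.
Proof. by case: e => // e; rewrite leq_exp2r. Qed.

Lemma ffact_le_expn (n m : nat) : n ^_ m <= n ^ m.
Proof.
rewrite ffact_prod -[m in X in _ <= X]card_ord -prod_nat_const.
by apply: leq_prod => i _; rewrite leq_subr.
Qed.

Lemma partition_porbits (X : finType) (p : {perm X}) :
  partition (porbits p) [set: X].
Proof.
suff -> : porbits p =
    equivalence_partition (fun x y => y \in porbit p x) [set: X].
  apply: equivalence_partitionP => x y z _ _ _.
  split=> [|/[1!porbit_sym] xy]; first exact: porbit_id.
  by rewrite -!eq_porbit_mem in xy *; rewrite (eqP xy).
apply/setP=> A; apply/imsetP/imsetP => -[x _ ->]; exists x => //;
  by apply/setP=> y; rewrite !inE.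
Qed.

(** A singleton orbit is a fixed point, and every other orbit has at least two elements. *)
Lemma card_porbits_le (X : finType) (p : {perm X}) :
  (#|porbits p|).*2 <= #|X| + #|[set x | p x == x]|.
Proof.
apply: leq_trans (_ : \sum_(A in porbits p) (#|A| + (#|A| == 1)) <= _).
  rewrite -muln2 -sum_nat_const; apply: leq_sum => _ /imsetP[x _ ->].
  by have := card_porbit_neq0 p x; lia.
rewrite big_split /= -(card_partition (partition_porbits p)) cardsT leq_add2l.
rewrite -big_mkcondr sum1_card.
apply: leq_trans (leq_imset_card (porbit p) _).
apply/subset_leq_card/subsetP=> _ /andP[/imsetP[x _ ->] /cards1P[y px]].
have xy : x = y by apply/set1P; rewrite -px porbit_id.
have pxx : p x = x.
  by have := mem_porbit p 1 x; rewrite expg1 px -xy => /set1P.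
by apply: imset_f; rewrite inE pxx.
Qed.

(** An invariant set is the union of the orbits it contains, so it is determined by a subset of
    [porbits p]. *)
Lemma card_fixed_sets (X : finType) (p : {perm X}) :
  #|[set A : {set X} | p @: A == A]| <= 2 ^ #|porbits p|.
Proof.
rewrite -card_powerset.
pose f (A : {set X}) := [set B in porbits p | B \subset A].
have fixed (A : {set X}) x : p @: A == A -> x \in A -> porbit p x \subset A.
  move=> /eqP pA xA; apply/subsetP=> y /porbitP[i ->].
  elim: i => [|i IHi]; first by rewrite expg0 perm1.
  by rewrite expgSr permM -pA imset_f.
have fK (A : {set X}) : p @: A == A -> cover (f A) = A.
  move=> pA; apply/setP=> x; rewrite /cover; apply/bigcupP/idP=> [[B]|xA].
    by rewrite inE => /andP[_ /subsetP]; apply.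
  by exists (porbit p x); rewrite ?porbit_id // inE imset_f ?fixed.
rewrite -(card_in_imset (f := f)).
  apply: subset_leq_card; apply/subsetP=> _ /imsetP[A _ ->].
  by rewrite inE; apply/subsetP=> B; rewrite inE => /andP[].
by move=> A B; rewrite !inE => pA pB eqf; rewrite -(fK A) // -(fK B) // eqf.
Qed.

(** Choose the support among the [a]-subsets, then a permutation of it: the product is the falling
    factorial [#|A| ^_ a]. *)
Lemma card_perm_moved (A : finType) (a : nat) :
  #|[set s : {perm A} | #|[set x | s x != x]| == a]| <= #|A| ^ a.
Proof.
apply: leq_trans (ffact_le_expn _ _).
rewrite -bin_ffact -card_draws -sum_nat_const.
apply: leq_trans (_ : \sum_(B in [set B : {set A} | #|B| == a])
  #|[set s in perm_on B]| <= _); last first.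
  by apply: leq_sum => B; rewrite inE cardsE card_perm => /eqP->.
apply: leq_trans (leq_card_bigcup _ _); apply: subset_leq_card.
apply/subsetP=> s; rewrite inE => sa; apply/bigcupP; exists [set x | s x != x].
  by rewrite inE.
by rewrite inE; apply/subsetP=> x; rewrite inE.
Qed.

(** * Matrices up to permutations of rows and columns *)

Definition pair_act (A B : finType) (x : A * B) (g : {perm A} * {perm B}) :=
  (g.1 x.1, g.2 x.2).

Lemma pair_act1 (A B : finType) : (@pair_act A B)^~ 1%g =1 id.
Proof. by case=> a b; rewrite /pair_act !perm1. Qed.

Lemma pair_actM (A B : finType) (x : A * B) : act_morph (@pair_act A B) x.
Proof. by move=> g h; rewrite /pair_act !permM. Qed.

Definition pair_action (A B : finType) :=
  TotalAction (@pair_act1 A B) (@pair_actM A B).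

Definition matrix_action (A B : finType) := set_action (pair_action A B).

Definition matrix_orbits (A B : finType) : {set {set {set A * B}}} :=
  [set orbit (matrix_action A B) [set: {perm A} * {perm B}] M
     | M in [set: {set A * B}]].

Lemma card_matrix_orbits_le (A B : finType) :
  #|matrix_orbits A B| <= 2 ^ (#|A| * #|B|).
Proof.
apply: leq_trans (leq_imset_card _ _) _.
by rewrite cardsT -cardsT -powersetT card_powerset cardsT card_prod.
Qed.

(** The powers of [#|A|] and [#|B|] are the bounds of [card_perm_moved]: the loss in fixed matrices
    pays for the number of permutations moving that many rows and columns. *)
Lemma card_fixed_matrices (A B : finType) (g : {perm A} * {perm B}) :
  #|A| ^ 4 <= 2 ^ #|B| -> #|B| ^ 4 <= 2 ^ #|A| ->
  #|('Fix_([set: {set A * B}] | matrix_action A B)[g])%g| *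
    #|A| ^ #|[set x | g.1 x != x]| * #|B| ^ #|[set y | g.2 y != y]| <= 2 ^ (#|A| * #|B|).
Proof.
move=> leAB leBA.
set p := actperm (pair_action A B) g.
set a := #|[set x | _]|; set b := #|[set x | _]|.
have fixE : #|('Fix_([set: {set A * B}] | matrix_action A B)[g])%g|
    <= 2 ^ #|porbits p|.
  apply: leq_trans (card_fixed_sets p); apply: subset_leq_card.
  apply/subsetP=> M /setIP[_ /afix1P /= fixM]; rewrite inE -[in X in _ == X]fixM.
  by apply/eqP/eq_imset => x; rewrite actpermE.
have porb := card_porbits_le p.
have fixp : #|[set x | p x == x]| = (#|A| - a) * (#|B| - b).
  have subC (T : finType) (s : {perm T}) :
      #|T| - #|[set x | s x != x]| = #|[set x | s x == x]|.
    rewrite -(cardsC [set x | s x != x]) addKn; congr #|pred_of_set _|.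
    by apply/setP=> x; rewrite !inE negbK.
  rewrite !subC -cardsX; apply: eq_card => -[x y].
  by rewrite !inE actpermE.
have lea : a <= #|A| by apply: max_card.
have leb : b <= #|B| by apply: max_card.
(* Fourth powers let the two hypotheses turn the weights into powers of 2. The exponents then
   compare because [2ab <= a #|B| + b #|A|], from [a <= #|A|] and [b <= #|B|]. *)
rewrite -(@leq_exp2r _ _ 4) // !expnMn.
apply: leq_trans (_ : 2 ^ (#|porbits p| * 4 + #|B| * a + #|A| * b) <= _).
  rewrite !(expnD _ (_ + _), expnD _ (_ * 4)) !leq_mul //.
  - by rewrite expnM leq_exp2r.
  - by rewrite expnAC expnM leq_expn2.
  - by rewrite expnAC expnM leq_expn2.
rewrite -expnM leq_exp2l //; rewrite fixp card_prod in porb; nia.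
Qed.

(** In Burnside's sum, the pairs are grouped by their numbers of moved rows and columns; each of the
    [#|A|.+1 * #|B|.+1] groups contributes at most [2 ^ (#|A| * #|B|)]. *)
Lemma card_matrix_orbits_fact (A B : finType) :
  #|A| ^ 4 <= 2 ^ #|B| -> #|B| ^ 4 <= 2 ^ #|A| ->
  #|matrix_orbits A B| * (#|A|`! * #|B|`!) <=
    #|A|.+1 * #|B|.+1 * 2 ^ (#|A| * #|B|).
Proof.
move=> leAB leBA.
set to := matrix_action A B.
have acts :
    [acts [set: {perm A} * {perm B}]%g, on [set: {set A * B}] | to]%g.
  by apply/subsetP=> g _; rewrite !inE; apply/subsetP=> M; rewrite !inE.
have cardP (T : finType) : #|{perm T}| = #|T|`!.
  rewrite -[in RHS]cardsT -card_perm; apply: eq_card => s.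
  by apply/esym/subsetP=> x; rewrite inE.
have := Frobenius_Cauchy acts.
rewrite -/(matrix_orbits A B) [#|[set: _]%G|]cardsT card_prod !cardP => <-.
pose moved (g : {perm A} * {perm B}) : 'I_#|A|.+1 * 'I_#|B|.+1 :=
  (inord #|[set x | g.1 x != x]|, inord #|[set y | g.2 y != y]|).
rewrite (partition_big moved xpredT) //=.
have -> : #|A|.+1 * #|B|.+1 * 2 ^ (#|A| * #|B|) =
    \sum_(ij : 'I_#|A|.+1 * 'I_#|B|.+1) 2 ^ (#|A| * #|B|).
  by rewrite sum_nat_const card_prod !card_ord.
apply: leq_sum => -[i j] _.
have card_ij : #|[set g | moved g == (i, j)]| <= #|A| ^ i * #|B| ^ j.
  apply: leq_trans (leq_mul (card_perm_moved A i) (card_perm_moved B j)).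
  rewrite -cardsX; apply/subset_leq_card/subsetP=> g.
  rewrite !inE => /eqP[<- <-].
  by rewrite !inordK ?ltnS ?max_card ?eqxx.
rewrite (eq_bigl [in [set g | moved g == (i, j)]]) => [|g]; last by rewrite !inE.
(* The weight is about to be cancelled; were it zero, the group would be empty. *)
have [ij0|ij_gt0] := posnP (#|A| ^ i * #|B| ^ j).
  move: card_ij; rewrite ij0 leqn0 cards_eq0 => /eqP->.
  by rewrite big_set0.
rewrite -(leq_pmul2r ij_gt0) big_distrl /=.
apply: (@leq_trans (\sum_(g in [set g | moved g == (i, j)]) 2 ^ (#|A| * #|B|))).
  apply: leq_sum => g; rewrite inE => /eqP[<- <-].
  by rewrite !inordK ?ltnS ?max_card // mulnA card_fixed_matrices.
by rewrite sum_nat_const mulnC leq_mul2l card_ij orbT.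
Qed.

(** * Adjacency, isomorphism and the number of KS-partitions *)

Lemma adj_sym (T : finType) (G : sgraph T) (x y : T) : adj G x y = adj G y x.
Proof.
case: G => e e_simple; move/andP: (e_simple) => [_].
by move=> /forallP/(_ x)/forallP/(_ y)/eqP.
Qed.

Lemma adj_irr (T : finType) (G : sgraph T) (x : T) : adj G x x = false.
Proof.
by case: G => e e_simple; move/andP: (e_simple) => [/forallP/(_ x)/negbTE].
Qed.

Lemma eq_sgraph (T : finType) (G H : sgraph T) :
  (forall x y, adj G x y = adj H x y) -> G = H.
Proof. by move=> GH; apply/val_inj/ffunP => -[x y]; apply: GH. Qed.

Lemma isomorphicP (T : finType) (G H : sgraph T) :
  reflect (exists f : {perm T}, forall x y, adj H (f x) (f y) = adj G x y)
          (isomorphic G H).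
Proof.
apply: (iffP existsP) => -[f fGH]; exists f.
  by move=> x y; apply/eqP; move/forallP/(_ x)/forallP: fGH; apply.
by apply/forallP=> x; apply/forallP=> y; rewrite fGH.
Qed.

Lemma cliqueP (T : finType) (G : sgraph T) (K : {set T}) :
  reflect {in K &, forall x y, x != y -> adj G x y} (clique G K).
Proof.
apply: (iffP forall_inP) => [GK x y xK yK|GK x xK].
  by move/forall_inP/(_ y yK)/implyP: (GK x xK).
by apply/forall_inP=> y yK; apply/implyP/GK.
Qed.

Lemma stableP (T : finType) (G : sgraph T) (S : {set T}) :
  reflect {in S &, forall x y, adj G x y = false} (stable G S).
Proof.
apply: (iffP forall_inP) => [GS x y xS yS|GS x xS].
  by move/forall_inP/(_ y yS)/negbTE: (GS x xS).
by apply/forall_inP=> y yS; rewrite GS.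
Qed.

Lemma KS_partitionP (T : finType) (G : sgraph T) (K S : {set T}) :
  reflect [/\ S = ~: K, {in K &, forall x y, x != y -> adj G x y} &
              {in S &, forall x y, adj G x y = false}]
          (KS_partition G (K, S)).
Proof.
apply: (iffP and4P) => /= [[/eqP KS dKS /cliqueP GK /stableP GS]|[-> GK GS]].
  split=> //; apply/setP=> x; have := in_setT x; rewrite -KS !inE.
  by case xK: (x \in K) => //= _; rewrite (disjointFr dKS).
by split; [rewrite setUCr | rewrite -subsets_disjoint
          | apply/cliqueP | apply/stableP].
Qed.

Lemma eq_pick_Some (T : finType) (P : pred T) (z : T) :
  (forall x y, P x -> P y -> x = y) -> ([pick x | P x] == Some z) = P z.
Proof.
move=> P1; case: pickP => [x Px|->] //.
by apply/eqP/idP => [[<-]|Pz] //; rewrite (P1 x z).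
Qed.

(** A clique and a stable set share at most one vertex. Hence, relative to a fixed KS-partition, any
    other one loses at most one vertex of [K] and gains at most one, and these two optional vertices
    determine it. *)
Lemma card_KS_partitions (T : finType) (G : sgraph T) :
  #|[set KS | KS_partition G KS]| <= #|T|.+1 ^ 2.
Proof.
case: (set_0Vmem [set KS | KS_partition G KS]) => [->|[[K S]]].
  by rewrite cards0.
rewrite inE => /KS_partitionP[-> GK GS].
pose f (KS : {set T} * {set T}) :=
  ([pick x in K :\: KS.1], [pick x in KS.1 :\: K]).
have fE KS : KS_partition G KS -> forall z,
    (((f KS).1 == Some z) = (z \in K :\: KS.1)) *
    (((f KS).2 == Some z) = (z \in KS.1 :\: K)).
  case: KS => K' S' /KS_partitionP[-> GK' GS'] z /=.
  split; apply: eq_pick_Some => {z} x y.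
    move=> /setDP[xK xK'] /setDP[yK yK']; apply: contraTeq isT => xy.
    by rewrite -(GK x y xK yK xy) GS' ?inE.
  move=> /setDP[xK xK'] /setDP[yK yK']; apply: contraTeq isT => xy.
  by rewrite -(GK' x y xK yK xy) GS ?inE.
have f_inj : {in [set KS | KS_partition G KS] &, injective f}.
  move=> KS1 KS2; rewrite !inE => P1 P2 eqf.
  have K12 : KS1.1 = KS2.1.
    apply/setP=> z; have := fE _ P1 z; rewrite eqf !(fE _ P2 z) !inE => -[].
    by case: (z \in K); case: (z \in KS1.1); case: (z \in KS2.1).
  case: KS1 KS2 P1 P2 K12 {eqf} => K1 S1 [K2 S2].
  by move=> /KS_partitionP[-> _ _] /KS_partitionP[-> _ _] /= ->.
rewrite -(card_in_imset f_inj) -mulnn -card_option -card_prod.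
exact: max_card.
Qed.

(** * Split graphs built from biadjacency matrices, and the lower bound on their number *)

Definition split_link (A B : finType) (M : {set A * B}) (u v : A + B) : bool :=
  match u, v with
  | inl _, inl _ => true
  | inl a, inr b | inr b, inl a => (a, b) \in M
  | inr _, inr _ => false
  end.

Lemma split_link_sym (A B : finType) (M : {set A * B}) (u v : A + B) :
  split_link M u v = split_link M v u.
Proof. by case: u v => [a|b] [a'|b']. Qed.

(** Since [split_link] relates each [inl a] to itself, loops are excluded by the separate
    conjunct. *)
Lemma split_of_subproof (T A B : finType) (c : T -> A + B) (M : {set A * B}) :
  simple_adj [ffun xy => (xy.1 != xy.2) && split_link M (c xy.1) (c xy.2)].
Proof.
apply/andP; split; first by apply/forallP=> x; rewrite ffunE eqxx.
apply/forallP=> x; apply/forallP=> y.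
by rewrite !ffunE /= [y == x]eq_sym [split_link _ (c y) _]split_link_sym.
Qed.

(* The split graph on [T] with clique [c^-1(A)], stable set [c^-1(B)] and
   biadjacency matrix [M]. *)
Definition split_of (T A B : finType) (c : T -> A + B) (M : {set A * B}) :
  sgraph T := SGraph (split_of_subproof c M).

Lemma adj_split_of (T A B : finType) (c : T -> A + B) (M : {set A * B}) x y :
  adj (split_of c M) x y = (x != y) && split_link M (c x) (c y).
Proof. exact: ffunE. Qed.

Lemma isomorphic_split_of (T A B A' B' : finType) (c : T -> A + B)
    (c' : T -> A' + B') (h : A + B -> A' + B') (M : {set A * B})
    (M' : {set A' * B'}) :
  injective c -> injective c' -> injective h -> #|T| = #|A'| + #|B'| ->
  (forall u v, split_link M' (h u) (h v) = split_link M u v) ->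
  isomorphic (split_of c M) (split_of c' M').
Proof.
move=> cI c'I hI cardT hM.
have [|d c'K dK] := inj_card_bij c'I; first by rewrite card_sum cardT.
have fI : injective (fun x => d (h (c x))).
  exact: inj_comp (can_inj dK) (inj_comp hI cI).
apply/isomorphicP; exists (perm fI) => x y.
by rewrite !adj_split_of !permE !dK hM (inj_eq fI).
Qed.

(** Composing the labelling with the inverse isomorphism leaves the matrix unchanged, so a whole
    isomorphism class is reached from one [M] by varying [c] alone. *)
Lemma split_of_isomorphic (T A B : finType) (c : T -> A + B) (M : {set A * B})
    (H : sgraph T) :
  injective c -> isomorphic (split_of c M) H ->
  exists2 c' : {ffun T -> A + B}, injective c' & H = split_of c' M.
Proof.
move=> cI /isomorphicP[f fH].
exists [ffun x => c (f^-1 x)%g] => [x y|].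
  by rewrite !ffunE => /cI/perm_inj.
apply: eq_sgraph => x y; rewrite adj_split_of !ffunE.
by rewrite -{1}[x](permKV f) -{1}[y](permKV f) fH adj_split_of (inj_eq perm_inj).
Qed.

Lemma KS_partition_split_of (T A B : finType) (c : T -> A + B)
    (M : {set A * B}) :
  KS_partition (split_of c M)
    ([set x | is_inl (c x)], ~: [set x | is_inl (c x)]).
Proof.
apply/KS_partitionP; split=> // x y; rewrite !inE adj_split_of.
  by case: (c x) (c y) => [a|b] [a'|b'] //= _ _ ->.
by case: (c x) (c y) => [a|b] [a'|b'] //= _ _; rewrite andbF.
Qed.

(** A matrix of [G] can be read off from a KS-partition together with an enumeration of [K] by [A]
    and one of [S] by [B]. *)
Lemma card_matrices_of_graph (T A B : finType) (G : sgraph T) :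
  #|T| = #|A| + #|B| ->
  #|[set M : {set A * B} |
      [exists c : {ffun T -> A + B}, injectiveb c && (G == split_of c M)]]| <=
    #|T|.+1 ^ 2 * (#|A|`! * #|B|`!).
Proof.
move=> cardT.
pose inj_to (D : finType) (K : {set T}) :=
  [set f : {ffun D -> T} in ffun_on (mem K) | injectiveb f].
pose mx (fg : {ffun A -> T} * {ffun B -> T}) :=
  [set p | adj G (fg.1 p.1) (fg.2 p.2)].
pose P (KS : {set T} * {set T}) := KS_partition G KS && (#|KS.1| == #|A|).
apply: leq_trans
  (_ : #|\bigcup_(KS | P KS) mx @: setX (inj_to A KS.1) (inj_to B KS.2)| <= _).
  apply/subset_leq_card/subsetP=> M; rewrite inE.
  case/existsP=> c /andP[/injectiveP cI /eqP GE].
  have [|d cK dK] := inj_card_bij cI; first by rewrite card_sum cardT.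
  have dI := can_inj dK.
  have := KS_partition_split_of c M; rewrite -GE.
  set K := [set x | _] => PK.
  apply/bigcupP; exists (K, ~: K); first rewrite /P PK /=.
    have -> : K = [set d (inl a) | a in [set: A]].
      apply/setP=> x; rewrite inE; apply/idP/imsetP => [|[a _ ->]].
        by case cx: (c x) => [a|] // _; exists a; rewrite ?inE // -cx cK.
      by rewrite dK.
    by rewrite card_imset ?cardsT // => a a' /dI[].
  apply/imsetP; exists ([ffun a => d (inl a)], [ffun b => d (inr b)]).
    rewrite !inE /=; do 2![apply/andP; split].
    - by apply/ffun_onP=> a; rewrite ffunE inE dK.
    - by apply/injectiveP=> a a'; rewrite !ffunE => /dI[].
    - by apply/ffun_onP=> a; rewrite ffunE !inE dK.
    - by apply/injectiveP=> a a'; rewrite !ffunE => /dI[].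
  apply/setP=> -[a b]; rewrite inE GE adj_split_of !ffunE !dK /=.
  by rewrite (inj_eq dI).
apply: leq_trans (leq_card_bigcup _ _) _.
apply: (@leq_trans (\sum_(KS | P KS) #|A|`! * #|B|`!)).
  apply: leq_sum => -[K S] /andP[/KS_partitionP[-> _ _] /= /eqP KA].
  apply: leq_trans (leq_imset_card _ _) _; rewrite cardsX !card_inj_ffuns_on.
  have KB : #|~: K| = #|B| by move: (cardsC K); rewrite cardT KA => /addnI.
  by rewrite -!ffactnn -KA -KB; apply: leqnn.
rewrite sum_nat_const leq_mul2r; apply/orP; right.
apply: leq_trans (card_KS_partitions G); apply/subset_leq_card/subsetP=> KS.
by rewrite !inE => /andP[].
Qed.

(** Each of the [2 ^ (k * s)] matrices yields a split graph, and [card_matrices_of_graph] bounds how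
    many matrices fall in one isomorphism class. *)
Lemma num_split_ge (k s : nat) :
  2 ^ (k * s) <= num_split (k + s) * ((k + s).+1 ^ 2 * (k`! * s`!)).
Proof.
rewrite -[2 ^ _](_ : #|[set: {set 'I_k * 'I_s}]| = _); last first.
  by rewrite -powersetT card_powerset cardsT card_prod !card_ord.
rewrite /num_split /num_unlabeled -sum_nat_const.
pose c := @split k s.
have cI : injective c by apply: can_inj (@splitK k s).
pose realizing (b : {set sgraph 'I_(k + s)}) := [set M | split_of c M \in b].
apply: leq_trans (leq_trans (subset_leq_card _)
                            (leq_card_bigcup _ realizing)) _; last first.
  apply: leq_sum => b /imsetP[G _ ->].
  have := @card_matrices_of_graph _ 'I_k 'I_s G; rewrite !card_ord => /(_ erefl).
  apply/leq_trans/subset_leq_card/subsetP=> M.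
  rewrite !inE isomorphic_sym => /andP[_].
  case/(split_of_isomorphic cI) => c' c'I ->; apply/existsP; exists c'.
  by rewrite eqxx andbT; apply/injectiveP.
apply/subsetP=> M _; apply/bigcupP.
have Msplit : split_of c M \in [set G | split_graph G].
  by rewrite inE; apply/existsP; eexists; apply: KS_partition_split_of.
eexists; first exact: imset_f Msplit.
by rewrite !inE in Msplit *; rewrite isomorphic_refl Msplit.
Qed.

(** * Unbalanced split graphs: the movable vertex and the upper bound *)

Lemma swing_vertex (T : finType) (G : sgraph T) :
  unbalanced_split G ->
  exists (v : T) (K : {set T}),
    [/\ v \notin K, KS_partition G (v |: K, ~: (v |: K)) &
        {in ~: (v |: K), forall y, adj G v y = false}].
Proof.
case/andP=> /existsP[[K1 S1] P1]; rewrite /balanced => unbal.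
have [[K2 S2] P2 neq12] : exists2 KS, KS_partition G KS & KS != (K1, S1).
  apply/exists_inP; apply: contraR unbal => /exists_inPn all1.
  apply/cards1P; exists (K1, S1); apply/setP=> KS; rewrite !inE.
  by apply/idP/eqP => [/all1|->] //; rewrite negbK => /eqP.
(* In a KS-partition [S] is the complement of [K], so distinct partitions have distinct cliques, and
   one of these is not contained in the other. *)
wlog [x xK1 xK2] : K1 S1 K2 S2 P1 P2 neq12 {unbal} /
    exists2 x, x \in K1 & x \notin K2.
  move=> wlog12; have [K12|] := boolP (K1 \subset K2); last first.
    by move=> /subsetPn; apply: (wlog12 _ _ _ _ P1 P2).
  have [K21|] := boolP (K2 \subset K1); last first.
    by move=> /subsetPn; apply: (wlog12 _ _ _ _ P2 P1); rewrite eq_sym.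
  case/negP: neq12; move: P1 P2.
  move=> /KS_partitionP[-> _ _] /KS_partitionP[-> _ _].
  by rewrite (_ : K1 = K2) //; apply/eqP; rewrite eqEsubset K12.
case/KS_partitionP: (P2) => S2E GK2 GS2; case/KS_partitionP: (P1) => S1E GK1 GS1.
rewrite S1E in P1 GS1; rewrite S2E in GS2.
(* [x] is in one clique and the other stable set: it serves as [v] unless it has
   a neighbour [y] in the first stable set, in which case [y] does. *)
have [[y yS1 xy]|noy] := altP
  (exists_inP (D := [in ~: K1]) (P := adj G x)); last first.
  exists x, (K1 :\ x); rewrite setD1K // !inE eqxx; split=> // y yS1.
  by apply/negbTE; apply: contra noy => xy; apply/exists_inP; exists y.
have yK1 : y \notin K1 by rewrite inE in yS1.
have yK2 : y \in K2.
  by apply: contraTT xy => yK2; rewrite GS2 ?inE.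
exists y, K1; split=> // [|z].
  apply/KS_partitionP; split=> //.
    (* As [x] lies in the second stable set, all its neighbours lie in [K2]; these include [y] and
       every other vertex of [K1]. *)
    have yK z : z \in K1 -> adj G y z.
      move=> zK1; have [->|zx] := eqVneq z x; first by rewrite adj_sym.
      have zK2 : z \in K2.
        by apply: contraTT (GK1 _ _ zK1 xK1 zx) => zK2; rewrite GS2 ?inE.
      by apply: GK2 => //; apply: contraNneq yK1 => ->.
    move=> u w /setU1P[->|uK] /setU1P[->|wK] uw; rewrite ?eqxx // in uw *.
    - exact: yK.
    - by rewrite adj_sym yK.
    - exact: GK1.
  by move=> u w; rewrite !inE => /norP[_ uK] /norP[_ wK]; apply: GS1; rewrite inE.
by rewrite !inE => /norP[_ zK]; apply: GS1; rewrite inE.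
Qed.

(* The new row [None] is the vertex [v]. *)
Definition add_empty_row (A B : finType) (M : {set A * B}) :
    {set option A * B} :=
  [set p | if p.1 is Some a then (a, p.2) \in M else false].

Lemma unbalanced_split_of (T : finType) (m : nat) (G : sgraph T) :
  #|T| = m.+1 -> unbalanced_split G ->
  exists (k : 'I_m.+1) (M : {set 'I_k * 'I_(m - k)})
      (c : {ffun T -> option 'I_k + 'I_(m - k)}),
    injective c /\ G = split_of c (add_empty_row M).
Proof.
move=> cardT /swing_vertex[v [K [vK PKS vS]]].
case/KS_partitionP: PKS => _ GK GS; set S := ~: (v |: K) in GS vS.
have := cardsC (v |: K); rewrite cardsU1 vK cardT -/S => cardKS.
have ltk : #|K| < m.+1 by lia.
have sE : m - Ordinal ltk = #|S| by rewrite /=; lia.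
exists (Ordinal ltk); rewrite sE /=.
(* Only [v] is in neither [K] nor [S]: its index in [enum S] is out of range, so [insub] fails and
   [v] gets the label [inl None]. *)
pose c x : option 'I_#|K| + 'I_#|S| :=
  if x \in K then inl (insub (index x (enum K)))
  else if insub (index x (enum S)) is Some b then inr b else inl None.
have cK x : x \in K -> exists2 a, c x = inl (Some a) & val a = index x (enum K).
  move=> xK; rewrite /c xK.
  have ltx : index x (enum K) < #|K| by rewrite cardE index_mem mem_enum.
  by exists (Ordinal ltx); rewrite ?insubT.
have cS x : x \in S -> exists2 a, c x = inr a & val a = index x (enum S).
  move=> xS; have xK : x \notin K by move: xS; rewrite !inE => /norP[].
  have ltx : index x (enum S) < #|S| by rewrite cardE index_mem mem_enum.
  by exists (Ordinal ltx) => //; rewrite /c (negbTE xK) insubT.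
have cv : c v = inl None.
  rewrite /c (negbTE vK) insubF // cardE index_mem mem_enum.
  by rewrite !inE eqxx.
have caseT x : [\/ x = v, x \in K | x \in S].
  rewrite !inE; case: eqVneq => [->|]; first by constructor 1.
  by case xK: (x \in K); [constructor 2|constructor 3].
have index_inj (D : {set T}) x y : x \in D -> y \in D ->
    index x (enum D) = index y (enum D) -> x = y.
  move=> xD yD eqi; have : x \in enum D by rewrite mem_enum.
  by move=> /(nth_index x) <-; rewrite eqi nth_index // mem_enum.
have cI : injective c.
{ move=> x y; case: (caseT x) => [->|xK|xS]; case: (caseT y) => [->|yK|yS] //.
  all: rewrite ?cv.
  all: try (have [a -> ax] := cK x xK); try (have [a -> ax] := cS x xS).
  all: try (have [b -> bx] := cK y yK); try (have [b -> bx] := cS y yS).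
  all: case=> // ab.
    by apply: (index_inj K); rewrite // -ax -bx ab.
  by apply: (index_inj S); rewrite // -ax -bx ab. }
pose M := [set p : 'I_#|K| * 'I_#|S| | [exists x, exists y,
  [&& c x == inl (Some p.1), c y == inr p.2 & adj G x y]]].
have ME x y a b : c x = inl (Some a) -> c y = inr b -> ((a, b) \in M) = adj G x y.
  move=> cx cy; rewrite inE; apply/existsP/idP => [[x' /existsP[y']]|Gxy].
    by rewrite -cx -cy /= !(inj_eq cI) => /and3P[/eqP-> /eqP->].
  by exists x; apply/existsP; exists y; rewrite cx cy !eqxx.
exists M, (finfun c); split=> [x y|].
  by rewrite !ffunE => /cI.
apply: eq_sgraph => x y; rewrite adj_split_of !ffunE.
have [<-|xy] := eqVneq x y; first by rewrite adj_irr.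
have K_vK z : z \in K -> z \in v |: K by apply: setU1r.
have v_vK : v \in v |: K by apply: setU11.
case: (caseT x) xy => [->|xK|xS]; case: (caseT y) => [->|yK|yS] xy /=.
- by rewrite eqxx in xy.
- by have [b -> _] := cK y yK; rewrite cv GK ?(v_vK, K_vK) //.
- by have [b -> _] := cS y yS; rewrite cv /= inE vS.
- by have [a -> _] := cK x xK; rewrite cv GK ?(v_vK, K_vK) //.
- have [a -> _] := cK x xK; have [b -> _] := cK y yK.
  by rewrite GK ?(v_vK, K_vK) //.
- have [a cx _] := cK x xK; have [b cy _] := cS y yS.
  by rewrite cx cy /= inE /= (ME x y).
- by have [a -> _] := cS x xS; rewrite cv /= inE adj_sym vS.
- have [a cx _] := cS x xS; have [b cy _] := cK y yK.
  by rewrite cx cy /= inE /= (ME y x) // adj_sym.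
- by have [a -> _] := cS x xS; have [b -> _] := cS y yS; rewrite GS.
Qed.

(** Permuting the rows and columns of [M] gives an isomorphic graph, so an orbit of matrices
    determines the isomorphism class; [F k] maps orbits to sets of graphs, and every class is among
    its values. *)
Lemma num_unbalanced_le (m : nat) :
  num_unbalanced m.+1 <= \sum_(k < m.+1) #|matrix_orbits 'I_k 'I_(m - k)|.
Proof.
rewrite /num_unbalanced /num_unlabeled.
pose U := [set G | @unbalanced_split 'I_m.+1 G].
pose F (k : 'I_m.+1) (O : {set {set 'I_k * 'I_(m - k)}}) :=
  [set H in U | [exists M in O,
     [exists c : {ffun 'I_m.+1 -> option 'I_k + 'I_(m - k)},
        injectiveb c && (H == split_of c (add_empty_row M))]]].
apply: leq_trans
  (_ : #|\bigcup_k F k @: matrix_orbits 'I_k 'I_(m - k)| <= _); last first.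
  apply: leq_trans (leq_card_bigcup _ _) _.
  by apply: leq_sum => k _; apply: leq_imset_card.
apply/subset_leq_card/subsetP=> _ /imsetP[G GU ->].
have := GU; rewrite inE => /(unbalanced_split_of (card_ord _))[k [M [c [cI GE]]]].
apply/bigcupP; exists k => //; apply/imsetP.
exists (orbit (matrix_action 'I_k 'I_(m - k)) [set: _]%g M).
  by apply: imset_f; rewrite inE.
apply/setP=> H; rewrite !inE; apply: andb_id2l => _.
apply/idP/exists_inP
  => [|[_ /orbitP[g _ <-] /existsP[c' /andP[/injectiveP c'I /eqP->]]]].
  rewrite {1}GE => /(split_of_isomorphic cI)[c' c'I ->].
  exists M; first exact: orbit_refl.
  by apply/existsP; exists c'; rewrite eqxx andbT; apply/injectiveP.
(* The row and column permutations [g] act on the labels, with the added row [None] kept fixed. *)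
pose h (u : option 'I_k + 'I_(m - k)) : option 'I_k + 'I_(m - k) :=
  match u with inl a => inl (omap g.1 a) | inr b => inr (g.2 b) end.
set M' : {set _} := act _ M g.
rewrite GE; apply: (isomorphic_split_of (h := h)) => //.
- by case=> [[a|]|b] [[a'|]|b'] //= [/perm_inj->].
- by rewrite card_ord card_option !card_ord; have := ltn_ord k; lia.
have gM a b : ((g.1 a, g.2 b) \in M') = ((a, b) \in M).
  exact: (mem_imset M (a, b) (act_inj (pair_action _ _) g)).
by case=> [[a|]|b] [[a'|]|b']; rewrite //= !inE //= gM.
Qed.

(** * Numerical estimates and comparison of the two bounds *)

Lemma poly_le_exp (m : nat) : 1792 <= m -> m.+2 ^ 7 <= 2 ^ (m %/ 16).
Proof.
move=> lem; set q := m %/ 16 %/ 14.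
have m2 : m.+2 <= 2 ^ (8 + q).
  have := ltn_expl q (isT : 1 < 2); rewrite expnD -[2 ^ 8]/256.
  have := ltn_ceil m (isT : 0 < 16); have := ltn_ceil (m %/ 16) (isT : 0 < 14).
  rewrite -/q; lia.
apply: leq_trans (leq_expn2 7 m2) _; rewrite -expnM leq_exp2l // /q; lia.
Qed.

Lemma fact_mul_le (k s : nat) : k`! * s`! <= (k + s)`!.
Proof.
by rewrite -(bin_fact (leq_addr s k)) addKn leq_pmull // bin_gt0 leq_addr.
Qed.

(** The right side is the floor of [(m + 1)^2 / 4], while the left side is at most
    [m * (2 * m + 5) / 16]. It settles the exponents when [k] or [s] is below [t]. *)
Lemma quarter_square_bound (m t : nat) :
  t * 16 <= m -> t * m + t * (m + 5) <= m.+1./2 * (m.+1 - m.+1./2).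
Proof.
move=> tm; have := leq_mul tm (leqnn (2 * m + 5)).
have [[h mE]|[h mE]] : (exists h, m = 2 * h) \/ (exists h, m = (2 * h).+1).
  by case: (boolP (odd m)) => mE; [right|left]; exists m./2; lia.
  have -> : m.+1./2 = h by lia.
  have -> : m.+1 - h = h.+1 by lia.
  rewrite mE; nia.
have -> : m.+1./2 = h.+1 by lia.
have -> : m.+1 - h.+1 = h.+1 by lia.
rewrite mE; nia.
Qed.

Lemma matrix_orbits_le_num_split (k s : nat) :
  (k + s).+2 ^ 7 <= 2 ^ ((k + s) %/ 16) ->
  #|matrix_orbits 'I_k 'I_s| * (k + s).+2 ^ 2 <= num_split (k + s).+1.
Proof.
set m := k + s; set t := m %/ 16 => mt.
have tm : t * 16 <= m := leq_divM _ _.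
have [/andP[tk ts]|tks] := boolP ((t <= k) && (t <= s)).
  have cond x y : x <= m -> t <= y -> x ^ 4 <= 2 ^ y.
    move=> xm ty; apply: leq_trans (_ : m.+2 ^ 7 <= _).
      apply: leq_trans (_ : m.+2 ^ 4 <= _); last by rewrite leq_pexp2l.
      by apply: leq_expn2; lia.
    by apply: leq_trans mt _; rewrite leq_exp2l.
  have := @card_matrix_orbits_fact 'I_k 'I_s.
  rewrite !card_ord.
  move=> /(_ (cond k s (leq_addr _ _) ts) (cond s k (leq_addl _ _) tk)).
  have := num_split_ge k s.+1.
  rewrite addnS -/m factS mulnS expnD.
  set N := #|matrix_orbits _ _|; set f := k`! * s`! => lbS ubN.
  have f_gt0 : 0 < f by rewrite muln_gt0 !fact_gt0.
  have D_gt0 : 0 < m.+2 ^ 2 * (f * s.+1).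
    by rewrite muln_gt0 expn_gt0 muln_gt0 f_gt0.
  rewrite -(leq_pmul2r D_gt0).
  apply: leq_trans (_ : _ <= 2 ^ k * 2 ^ (k * s)) _; last first.
    by move: lbS; rewrite /f; lia.
  apply: leq_trans (_ : k.+1 * s.+1 * 2 ^ (k * s) * (m.+2 ^ 4 * s.+1) <= _).
    (* The power [m.+2 ^ 4] joins the square being proved to the square from [num_split_ge]; with
       [k.+1 * s.+1 * s.+1] it stays below [m.+2 ^ 7], which the gained factor [2 ^ k] absorbs. *)
    rewrite (_ : _ * _ * _ = N * f * (m.+2 ^ 4 * s.+1)); last by lia.
    by rewrite leq_mul2r ubN orbT.
  rewrite (_ : _ * _ = k.+1 * s.+1 * s.+1 * m.+2 ^ 4 * 2 ^ (k * s)); last by lia.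
  rewrite leq_mul2r; apply/orP; right.
  apply: leq_trans (_ : m.+2 ^ 7 <= _); last first.
    by apply: leq_trans mt _; rewrite leq_exp2l.
  by rewrite (_ : 7 = 1 + 1 + 1 + 4) // !expnD !expn1 !leq_mul //; lia.
have ks : k * s <= t * m.
  by move: tks; rewrite negb_and -!ltnNge => /orP[] lt; nia.
pose h := m.+1./2.
have := num_split_ge h (m.+1 - h).
have hm : h + (m.+1 - h) = m.+1 by rewrite /h; lia.
rewrite hm => lbS.
have D_gt0 : 0 < m.+2 ^ 2 * m.+1`! by rewrite muln_gt0 expn_gt0 fact_gt0.
rewrite -(leq_pmul2r D_gt0).
apply: leq_trans (_ : 2 ^ (h * (m.+1 - h)) <= _); last first.
  apply: leq_trans lbS _; rewrite -!mulnA !leq_mul2l.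
  by have := fact_mul_le h (m.+1 - h); rewrite hm => ->; rewrite !orbT.
have fm : m.+1`! <= m.+2 ^ m.+1.
  by rewrite -ffactnn; apply: leq_trans (ffact_le_expn _ _) _; apply: leq_expn2.
have Nm := @card_matrix_orbits_le 'I_k 'I_s; rewrite !card_ord in Nm.
apply: leq_trans (_ : 2 ^ (t * m) * m.+2 ^ 2 * (m.+2 ^ 2 * m.+2 ^ m.+1) <= _).
  rewrite !leq_mul //; apply: leq_trans Nm _; rewrite leq_exp2l //.
rewrite -mulnA -!expnD.
apply: leq_trans (_ : 2 ^ (t * m) * (2 ^ t) ^ (m + 5) <= _).
  rewrite leq_mul2l; apply/orP; right.
  apply: leq_trans (leq_expn2 _ mt); rewrite -expnM leq_pexp2l //; lia.
rewrite -expnM -expnD leq_exp2l //.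
exact: quarter_square_bound.
Qed.

(** With [n = m.+1], each of the [m.+1] terms is smaller than [num_split n] by a factor [m.+2 ^ 2],
    so their sum is smaller by a factor [m.+2]. *)
Lemma num_unbalanced_mul_le (n : nat) :
  1793 <= n -> num_unbalanced n * n.+1 <= num_split n.
Proof.
case: n => // m lem.
apply: (@leq_trans (\sum_(k < m.+1) #|matrix_orbits 'I_k 'I_(m - k)| * m.+2)).
  by rewrite -big_distrl leq_mul2r num_unbalanced_le orbT.
apply: (@leq_trans (\sum_(k < m.+1) num_split m.+1 %/ m.+2)).
  apply: leq_sum => k _; rewrite leq_divRL // -mulnA mulnn.
  have km : k + (m - k) = m by have := ltn_ord k; lia.
  have := @matrix_orbits_le_num_split k (m - k).
  by rewrite km; apply; apply: poly_le_exp.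
rewrite sum_nat_const card_ord.
apply: leq_trans (leq_divM (num_split m.+1) m.+2).
by rewrite mulnC leq_mul2l leqnSn orbT.
Qed.

(* Passage to the limit *)
From mathcomp Require Import all_order all_algebra.
From mathcomp Require Import all_classical all_reals all_analysis.

Import Order.TTheory GRing.Theory Num.Theory.
Import numFieldNormedType.Exports.
Local Open Scope classical_set_scope.
Local Open Scope ring_scope.

Theorem theorem3p14 (R : realType) :
  (fun n : nat => (num_unbalanced n)%:R / (num_split n)%:R : R) @ \oo
    --> (0 : R).
Proof.
(* The ratio is squeezed between 0 and the harmonic sequence [1 / (n + 1)]. *)
apply: (squeeze_cvgr _ (cvg_cst 0) (@cvg_harmonic R)).
exists 1793%N => // n /= len; rewrite divr_ge0 //= /harmonic.
(* Clearing the denominator requires it to be nonzero; with a zero denominator the quotient is 0 by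
   convention. *)
have [->|s_neq0] := eqVneq (num_split n) 0%N; first by rewrite invr0 mulr0.
rewrite ler_pdivrMr ?ltr0n ?lt0n // mulrC ler_pdivlMr ?ltr0n // -natrM ler_nat.
exact: num_unbalanced_mul_le.
Qed.
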